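(* Let $G=(V,E)$ be a finite simple undirected graph and $\mathcal{S}=\prod_{i\in V}\mathcal{S}_i$ with each $\mathcal{S}_i$ finite. Then the map $\psi\colon\mathrm{PGG}(G,\mathcal{S})\to\mathrm{MRF}(G,\mathcal{S})$ given by $[\psi(\Phi)](a)=e^{\Phi(a)}$ for $a\in\mathcal{S}$ is a bijection.
   Context: A game with player set $V$ and strategy profile set $\mathcal{S}$ is given by utilities $u_i\colon\mathcal{S}\to\mathbb{R}$, $i\in V$. Fix an arbitrary distinguished strategy $o_i\in\mathcal{S}_i$ for each $i$; for $a\in\mathcal{S}$, $a^i$ denotes the profile obtained from $a$ by replacing $a_i$ with $o_i$. The game is a graphical game on $G$ if whenever $i\ne j$ and $(i,j)\notin E$, $u_i(a)=u_i(a^j)$ for all $a\in\mathcal{S}$. It is a potential game with potential $\Phi\colon\mathcal{S}\to\mathbb{R}$ if $u_i(a)-u_i(a^i)=\Phi(a)-\Phi(a^i)$ for all $i\in V$, $a\in\mathcal{S}$. (Neither notion depends on the choice of the $o_i$.) $\mathrm{PGG}(G,\mathcal{S})\subset\mathbb{R}^{\mathcal{S}}$ is the set of potentials $\Phi$, normalized by $\sum_{a\in\mathcal{S}}e^{\Phi(a)}=1$, of games with strategy profile set $\mathcal{S}$ that are both graphical games on $G$ and potential games. A random field on $G$ is a random vector $X=(X_i)_{i\in V}$. For $U,W\subseteq V$, a subset $A\subseteq V$ is a $(U,W)$-cut if every path in $G$ from $U$ to $W$ must pass through $A$. $X$ is a Markov random field if for every $(U,W)$-cut $A$, conditioned on $X_A$,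 $X_U$ is independent of $X_W$, where $X_Z=(X_i)_{i\in Z}$. A random field $X$ is positive if its distribution is equivalent (in the sense of mutual absolute continuity) to the product of its marginal distributions; for discrete distributions this means that the event $X=a$ has positive probability whenever each of the events $X_i=a_i$, $i\in V$, has positive probability. $\mathrm{MRF}(G,\mathcal{S})$ is the set of probability measures on $\mathcal{S}$ that describe positive Markov random fields with underlying graph $G$.
   Formalization: MRF(G,S) is taken to contain only fields in which every strategy s in S_i has positive marginal probability P(X_i=s)>0; with positivity read literally, a point mass would be a positive Markov random field not of the form e^Φ, and surjectivity would fail. *)

(* Defs.v *)
From mathcomp Require Import all_boot all_order all_algebra.
From mathcomp Require Import all_classical all_reals all_analysis.

Set Implicit Arguments.
Unset Strict Implicit.
Unset Printing Implicit Defensive.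

Import Order.TTheory GRing.Theory Num.Theory.
Local Open Scope ring_scope.

Definition profile (V : finType) (S : V -> finType) : finType :=
  {dffun forall i : V, S i}.

(* The profile written a^i: the strategy of i is replaced by o i. *)
Definition reset (V : finType) (S : V -> finType) (o a : profile S) (i : V) :
    profile S :=
  [ffun j : V => (if j == i then o j else a j) : S j].

Definition graphical_game (R : realType) (V : finType) (E : rel V)
    (S : V -> finType) (o : profile S) (u : V -> profile S -> R) : Prop :=
  forall i j : V, i != j -> ~~ E i j ->
  forall a : profile S, u i a = u i (reset o a j).

Definition potential_game (R : realType) (V : finType) (S : V -> finType)
    (o : profile S) (u : V -> profile S -> R) (Phi : profile S -> R) : Prop :=
  forall (i : V) (a : profile S),
    u i a - u i (reset o a i) = Phi a - Phi (reset o a i).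

Definition PGG (R : realType) (V : finType) (E : rel V) (S : V -> finType)
    (o : profile S) : set (profile S -> R) :=
  [set Phi : profile S -> R |
    \sum_(a : profile S) expR (Phi a) = 1 /\
    exists u : V -> profile S -> R,
      graphical_game E o u /\ potential_game o u Phi]%classic.

(* A trivial path (p = [::]) is allowed, so a cut contains U :&: W. *)
Definition is_cut (V : finType) (E : rel V) (U W A : {set V}) : Prop :=
  forall (x : V) (p : seq V), path E x p -> x \in U -> last x p \in W ->
  exists2 z : V, z \in x :: p & z \in A.

(* A measure on the finite set of profiles is given by its mass function, and
   the random field is the identity map on profiles. *)
Definition is_distribution (R : realType) (T : finType) (mu : T -> R) : Prop :=
  (forall a, 0 <= mu a) /\ \sum_a mu a = 1.

Definition Pr (R : realType) (T : finType) (mu : T -> R) (B : pred T) : R :=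
  \sum_(a | B a) mu a.

Definition condPr (R : realType) (T : finType) (mu : T -> R) (B C : pred T) :
    R :=
  Pr mu (predI B C) / Pr mu C.

(* The event X_Z = a_Z. *)
Definition agree (V : finType) (S : V -> finType) (Z : {set V})
    (a : profile S) : pred (profile S) :=
  fun x => [forall i in Z, x i == a i].

(* Any two profiles b, c with arbitrary restrictions to U, W are allowed, also
   when U, W and A overlap. *)
Definition cond_indep (R : realType) (V : finType) (S : V -> finType)
    (mu : profile S -> R) (U W A : {set V}) : Prop :=
  forall a b c : profile S, 0 < Pr mu (agree A a) ->
    condPr mu (predI (agree U b) (agree W c)) (agree A a) =
    condPr mu (agree U b) (agree A a) * condPr mu (agree W c) (agree A a).

Definition markov (R : realType) (V : finType) (E : rel V) (S : V -> finType)
    (mu : profile S -> R) : Prop :=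
  forall U W A : {set V}, is_cut E U W A -> cond_indep mu U W A.

Definition marginal (R : realType) (V : finType) (S : V -> finType)
    (mu : profile S -> R) (i : V) (s : S i) : R :=
  Pr mu (fun x : profile S => x i == s).

Definition positive_field (R : realType) (V : finType) (S : V -> finType)
    (mu : profile S -> R) : Prop :=
  forall a : profile S, (forall i, 0 < marginal mu (a i)) -> 0 < mu a.

(* S i is the set of values that X_i actually takes.  Without this convention
   a point mass would be a positive Markov random field, while no mass function
   of the form exp \o Phi vanishes anywhere. *)
Definition full_marginals (R : realType) (V : finType) (S : V -> finType)
    (mu : profile S -> R) : Prop :=
  forall (i : V) (s : S i), 0 < marginal mu s.

Definition MRF (R : realType) (V : finType) (E : rel V) (S : V -> finType) :
    set (profile S -> R) :=
  [set mu : profile S -> R |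
    [/\ is_distribution mu, full_marginals mu, positive_field mu &
        markov E mu]]%classic.

Definition psi (R : realType) (V : finType) (S : V -> finType)
    (Phi : profile S -> R) : profile S -> R :=
  fun a => expR (Phi a).

(* Main.v *)
(* Potentials of graphical games and logarithms of positive Markov random fields
   are the same thing: functions whose increment in coordinate i depends only on
   the coordinates in the closed neighborhood of i.  For a potential game this
   increment is the increment of u_i, and it may itself serve as u_i.  For a
   Markov field one conditions on the neighbors of i, which cut i off from the
   rest.  Conversely, if A is a (U,W)-cut and B a union of components of the
   complement of A, locality lets two profiles agreeing on A exchange their
   restrictions to B without changing the product of their weights, which is
   conditional independence. *)
Require Import Defs.
From mathcomp Require Import all_boot all_order all_algebra.
From mathcomp Require Import all_classical all_reals all_analysis.
From mathcomp Require Import ring lra.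

Set Implicit Arguments.
Unset Strict Implicit.
Unset Printing Implicit Defensive.

Import Order.TTheory GRing.Theory Num.Theory.
Local Open Scope ring_scope.

Definition splice (V : finType) (S : V -> finType) (B : {set V})
    (y x : profile S) : profile S :=
  [ffun j : V => (if j \in B then y j else x j) : S j].

(** Pairs of profiles differing at most at [i] stand for updates of coordinate [i], which avoids
    inserting a dependently typed value of [S i]. *)
Definition local_potential (R : realType) (V : finType) (E : rel V)
    (S : V -> finType) (Phi : profile S -> R) : Prop :=
  forall (i : V) (x z x' z' : profile S),
    (forall j, j != i -> x j = z j) ->
    (forall j, j != i -> x' j = z' j) ->
    (forall j, (j == i) || E i j -> x j = x' j /\ z j = z' j) ->
    Phi x - Phi z = Phi x' - Phi z'.

(** Induction on an enumeration of [C]; it lifts one-coordinate arguments to [splice C]. *)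
Lemma setU1_invariant (V : finType) (T : Type) (g : {set V} -> T)
    (C : {set V}) :
  (forall i B, i \in C -> g (i |: B) = g B) -> g C = g finset.set0.
Proof.
move=> gU; rewrite -[in LHS](set_enum C).
have: {subset enum C <= C} by move=> i; rewrite mem_enum.
elim: (enum C) => [|i s IHs] sC; first by rewrite finset.set_nil.
rewrite finset.set_cons gU ?IHs ?sC ?mem_head // => j js.
by rewrite sC // in_cons js orbT.
Qed.

Section Profiles.
Variables (R : realType) (V : finType) (E : rel V) (S : V -> finType).
Implicit Types (x y z a b c o : profile S) (A B C U W Z : {set V}).
Implicit Types (Phi mu : profile S -> R).

Lemma splice0 x y : splice finset.set0 y x = x.
Proof. by apply/ffunP => j; rewrite ffunE inE. Qed.

Lemma spliceU1 i B x y : splice (i |: B) y x = reset y (splice B y x) i.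
Proof. by apply/ffunP => j; rewrite !ffunE !inE; case: eqP. Qed.

Lemma agreeP Z a x : reflect (forall i, i \in Z -> x i = a i) (agree Z a x).
Proof.
apply: (iffP forallP) => [H i iZ|H i]; first by apply/eqP/(implyP (H i)).
by apply/implyP => /H/eqP.
Qed.

Lemma eq_agree Z a b : (forall i, i \in Z -> a i = b i) ->
  agree Z a = agree Z b.
Proof.
move=> ab; apply/funext => x; apply/agreeP/agreeP => H i iZ.
  by rewrite H // ab.
by rewrite H // ab.
Qed.

(** Resetting, one by one, all coordinates outside the closed neighborhood of [i] preserves [u i]
    and makes [x] and [x'] coincide. *)
Lemma graphical_game_local o (u : V -> profile S -> R) i x x' :
  graphical_game E o u -> (forall j, (j == i) || E i j -> x j = x' j) ->
  u i x = u i x'.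
Proof.
move=> gu xx'; pose C := [set j | ~~ ((j == i) || E i j)].
have uC y : u i (splice C o y) = u i y.
  rewrite -[in RHS](splice0 y o).
  apply: (setU1_invariant (g := fun B => u i (splice B o y))) => j B.
  rewrite inE negb_or eq_sym => /andP[ij nEij].
  by rewrite spliceU1 -gu.
rewrite -uC -[RHS]uC; congr (u i _); apply/ffunP => j.
by rewrite !ffunE inE; case: ifPn => // /negPn/xx'.
Qed.

Lemma potential_game_local o (u : V -> profile S -> R) Phi :
  graphical_game E o u -> potential_game o u Phi -> local_potential E Phi.
Proof.
move=> gu pu i x z x' z' xz xz' xzE.
have diff (y w : profile S) : (forall j, j != i -> y j = w j) ->
    Phi y - Phi w = u i y - u i w.
  move=> yw; have := pu i y; have := pu i w.
  (* As [y] and [w] differ at most at [i], their resets coincide and cancel. *)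
  have -> : reset o y i = reset o w i; last by lra.
  by apply/ffunP => j; rewrite !ffunE; case: eqP => // /eqP/yw.
rewrite !diff // (graphical_game_local (x := x) (x' := x') gu); last first.
  by move=> j /xzE[].
by rewrite (graphical_game_local (x := z) (x' := z') gu) // => j /xzE[].
Qed.

Lemma local_potential_game o Phi : local_potential E Phi ->
  exists u : V -> profile S -> R,
    graphical_game E o u /\ potential_game o u Phi.
Proof.
move=> lP; exists (fun i a => Phi a - Phi (reset o a i)).
split=> [i j ij nE a|i a].
  apply: (lP i) => k; rewrite !ffunE.
  - by move/negPf ->.
  - by move/negPf ->.
  - by case: (k =P j) => [->|//]; rewrite eq_sym (negPf ij) (negPf nE).
(* Resetting is idempotent, so [u i] vanishes at the reset profile. *)
have -> : reset o (reset o a i) i = reset o a i; last by lra.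
by apply/ffunP => j; rewrite !ffunE; case: eqP.
Qed.

(** Overwriting the coordinates in [B] one at a time changes [Phi] equally at both profiles, as they
    agree on each closed neighborhood involved. *)
Lemma local_potential_splice Phi B x x' y : local_potential E Phi ->
  (forall i j, i \in B -> (j == i) || E i j -> x j = x' j) ->
  Phi (splice B y x) - Phi (splice B y x') = Phi x - Phi x'.
Proof.
move=> lP xx'; rewrite -[in RHS](splice0 x y) -[in RHS](splice0 x' y).
apply: (setU1_invariant
  (g := fun B => Phi (splice B y x) - Phi (splice B y x'))) => i C iB.
suff : Phi (splice (i |: C) y x) - Phi (splice C y x) =
       Phi (splice (i |: C) y x') - Phi (splice C y x') by lra.
apply: (lP i) => j; rewrite !ffunE !inE.
- by move/negPf ->.
- by move/negPf ->.
- by move=> ij; rewrite (xx' i j).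
Qed.

(** [B] collects the vertices reachable from [U :\: A] without entering [A]. Reaching [W] would
    contradict the cut, and an edge leaving [B] must end in [A]. *)
Lemma cut_component U W A : is_cut E U W A ->
  exists B : {set V}, [/\ U \subset A :|: B, [disjoint W & B] &
    forall i j, i \in B -> E i j -> j \in A :|: B].
Proof.
move=> cutA; pose e := [rel x y | E x y && (y \notin A)].
exists [set v | [exists u in U :\: A, connect e u v]]; split.
- apply/fintype.subsetP => u uU; rewrite !inE.
  case: (boolP (u \in A)) => //= uA.
  by apply/existsP; exists u; rewrite !inE uA uU connect0.
- apply/pred0P => w; apply/negP => /andP[/= wW].
  rewrite inE => /existsP[u /andP[]]; rewrite inE => /andP[uA uU].
  case/connectP => q ep ew.
  have [Ep Ap] : path E u q /\ all (fun v => v \notin A) q.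
    elim: q {ew} u {uA uU} ep => //= v q IHq u /andP[/andP[-> ->]].
    by move/IHq => [-> ->].
  have [|z] := cutA u q Ep uU; first by rewrite -ew.
  rewrite in_cons => /predU1P[->|zq]; first exact/negP.
  by apply/negP/(allP Ap).
- move=> i j; rewrite !inE => /existsP[u /andP[uUA ui]] Eij.
  case: (boolP (j \in A)) => //= jA; apply/existsP; exists u.
  by rewrite uUA (connect_trans ui) // connect1 //= Eij.
Qed.

Lemma cut_neighbors i :
  is_cut E [set i] [set j | (j != i) && ~~ E i j] [set j | E i j].
Proof.
move=> x [|v p] /=; rewrite !inE; first by move=> _ /eqP ->; rewrite eqxx.
by move=> /andP[xv _] /eqP xi _; exists v; rewrite !inE ?eqxx ?orbT // -xi.
Qed.

Lemma PrM (T : finType) (mu : T -> R) (B C : pred T) :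
  Pr mu B * Pr mu C =
  \sum_(p : T * T | B p.1 && C p.2) mu p.1 * mu p.2.
Proof. by rewrite /Pr big_distrlr pair_big. Qed.

Lemma condPr_indepE (T : finType) (mu : T -> R) (B C D : pred T) :
  0 < Pr mu D ->
  (condPr mu (predI B C) D = condPr mu B D * condPr mu C D) <->
  (Pr mu (predI (predI B C) D) * Pr mu D =
   Pr mu (predI B D) * Pr mu (predI C D)).
Proof.
rewrite /condPr => /lt0r_neq0 D0; split=> [/(congr1 ( *%R^~ (Pr mu D ^+ 2)))|].
  move=> H; apply: etrans (etrans H _); by field.
by move=> H; rewrite mulf_div -H -mulf_div mulfV // mulr1.
Qed.

Lemma local_potential_markov Phi :
  local_potential E Phi -> Defs.markov E (psi Phi).
Proof.
move=> lP U W A cutA a b c A0; apply/condPr_indepE => //.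
have [B [UAB /disjointFr WB BE]] := cut_component cutA.
(* Both sides are sums over pairs of profiles. The involution [swap] keeps the coordinates in [B],
   exchanges the others, and matches the two index sets. *)
pose swap (p : profile S * profile S) := (splice B p.1 p.2, splice B p.2 p.1).
have swapK : involutive swap.
  move=> [x y]; rewrite /swap /=; congr (_, _); apply/ffunP => j;
  by rewrite !ffunE; case: ifP => jB; rewrite ?jB.
rewrite !PrM (reindex_inj (inv_inj swapK)); apply: eq_big => [[x y]|[x y]] /=.
  apply/andP/andP => -[].
    move=> /andP[/andP[/agreeP xU /agreeP xW] /agreeP xA] /agreeP yA.
    have {}xyA i : i \in A -> x i = a i /\ y i = a i.
      by move=> iA; move: (xA i iA) (yA i iA); rewrite !ffunE; case: ifP.
    split; apply/andP; split; apply/agreeP => i iZ; try by have [] := xyA i iZ.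
      have := xU i iZ; rewrite ffunE; case: ifPn => // iB <-.
      have := fintype.subsetP UAB i iZ; rewrite inE (negPf iB) orbF.
      by case/xyA => -> ->.
    by have := xW i iZ; rewrite ffunE (WB i iZ).
  move=> /andP[/agreeP xU /agreeP xA] /andP[/agreeP yW /agreeP yA].
  split; [apply/andP; split; [apply/andP; split|] |]; apply/agreeP => i iZ;
    rewrite ffunE.
  - case: ifPn => [_|iB]; first exact: xU.
    have := fintype.subsetP UAB i iZ; rewrite inE (negPf iB) orbF => iA.
    by rewrite yA // -xA // xU.
  - by rewrite (WB i iZ) yW.
  - by case: ifP => _; rewrite ?xA ?yA.
  - by case: ifP => _; rewrite ?xA ?yA.
move=> /andP[/andP[_ /agreeP xA] /agreeP yA].
have {}xyA i : i \in A -> x i = y i.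
  by move=> iA; move: (xA i iA) (yA i iA); rewrite !ffunE; case: ifP => _ -> ->.
rewrite /psi -!expRD; congr expR.
have yE : splice B y (splice B x y) = y.
  by apply/ffunP => j; rewrite !ffunE; case: ifP => jB; rewrite ?jB.
(* [x] and [splice B x y] agree on [B] and on its outside neighbors, which lie in [A], where [x] and
   [y] coincide. *)
have := @local_potential_splice Phi B x (splice B x y) y lP.
rewrite yE => H; rewrite addrC; apply/eqP; rewrite -subr_eq0; apply/eqP.
rewrite -[X in _ = X](subrr (Phi x - Phi (splice B x y))) -{1}H; first by ring.
move=> i j iB; rewrite ffunE; case: ifPn => // jB.
case/orP => [/eqP ji|/(BE _ _ iB)]; first by rewrite ji iB in jB.
by rewrite inE (negPf jB) orbF => /xyA.
Qed.

Lemma Pr_gt0 (T : finType) (mu : T -> R) (B : pred T) (t : T) :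
  (forall s, 0 < mu s) -> B t -> 0 < Pr mu B.
Proof.
move=> mu0 Bt; rewrite /Pr (bigD1 t) //= ltr_wpDr ?mu0 //.
by apply: sumr_ge0 => s _; apply: ltW.
Qed.

Lemma agree_refl Z a : agree Z a a.
Proof. exact/agreeP. Qed.

(* Conditioning on the neighbors of i makes mu x proportional, as a function of
   x i alone, to the joint weight of x i and the neighbors. *)
Lemma markov_local_potential mu :
  irreflexive E -> (forall a, 0 < mu a) -> Defs.markov E mu ->
  local_potential E (fun a => ln (mu a)).
Proof.
move=> Eirr mu0 mk i x z x' z' xz xz' xzE.
pose A := [set j | E i j]; pose W := [set j | (j != i) && ~~ E i j].
pose N a := Pr mu (predI (agree [set i] a) (agree A a)).
pose M a := Pr mu (agree A a).
have N0 a : 0 < N a by apply: (@Pr_gt0 _ _ _ a); rewrite //= !agree_refl.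
have M0 a : 0 < M a by apply: (@Pr_gt0 _ _ _ a); rewrite //= !agree_refl.
(* The sets [[set i]], [W] and [A] cover [V], so the joint event is the single profile [a]. *)
have muE a : mu a * M a = N a * Pr mu (predI (agree W a) (agree A a)).
  have /(condPr_indepE _ _ (M0 a)) <- :=
    mk _ _ _ (@cut_neighbors i) a a a (M0 a).
  congr (_ * _); rewrite /Pr (big_pred1 a) // => y /=.
  apply/andP/eqP => [[/andP[/agreeP yi /agreeP yW] /agreeP yA]|->].
    apply/ffunP => j; have [->|ji] := eqVneq j i; first by rewrite yi ?inE.
    case: (boolP (E i j)) => Eij; first by rewrite yA ?inE.
    by rewrite yW ?inE ?ji.
  by rewrite !agree_refl.
(* The events on [A] and [W] do not involve coordinate [i], so their weights cancel in the ratio. *)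
have ratio (b d : profile S) : (forall j, j != i -> b j = d j) ->
    ln (mu b) - ln (mu d) = ln (N b) - ln (N d).
  move=> bd; have := muE d.
  have eqA : agree A d = agree A b.
    apply/eq_agree => j; rewrite inE => Eij; rewrite bd //.
    by apply: contraL Eij => /eqP ->; rewrite Eirr.
  have eqW : agree W d = agree W b.
    by apply/eq_agree => j; rewrite inE => /andP[ji _]; rewrite bd.
  rewrite {1}/M eqA eqW => muEd.
  have : mu b * N d = mu d * N b.
    apply: (mulIf (lt0r_neq0 (M0 b))).
    by rewrite mulrAC muE [RHS]mulrAC muEd; ring.
  move/(congr1 (@ln R)); rewrite !lnM ?posrE //; lra.
have NE (b d : profile S) :
    (forall j, (j == i) || E i j -> b j = d j) -> N b = N d.
  move=> bd; rewrite /N (@eq_agree [set i] b d) ?(@eq_agree A b d) // => j.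
    by rewrite inE => Eij; rewrite bd // Eij orbT.
  by rewrite inE => ji; rewrite bd // ji.
by rewrite !ratio // (NE x x') ?(NE z z') // => j /xzE[].
Qed.

Lemma psi_MRF o Phi : \sum_a psi Phi a = 1 -> Defs.markov E (psi Phi) ->
  MRF E (psi Phi).
Proof.
move=> sum1 mk; split=> //; first by split=> // a; apply: expR_ge0.
  (* The profile [o] with coordinate [i] replaced by [s]; the cast moves [s] from [S i] to [S j]. *)
  move=> i s; pose a : profile S := [ffun j =>
    if j =P i is ReflectT ji then ecast k (S k) (esym ji) s else o j].
  apply: (@Pr_gt0 _ _ _ a) => [x|]; first exact: expR_gt0.
  by rewrite ffunE; case: eqP => // ii; rewrite (eq_axiomK ii).
by move=> a _; apply: expR_gt0.
Qed.

End Profiles.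

Theorem proposition4p6 (R : realType) (V : finType) (E : rel V)
    (Esym : symmetric E) (Eirr : irreflexive E)
    (S : V -> finType) (o : profile S) :
  set_bij (@PGG R V E S o) (@MRF R V E S) (@psi R V S).
Proof.
split.
- move=> Phi [sum1 [u [gu pu]]]; apply: (psi_MRF o sum1 _).
  exact/local_potential_markov/(potential_game_local gu pu).
- move=> Phi Psi _ _ eqpsi; apply/funext => a.
  exact/expR_inj/(congr1 (@^~ a) eqpsi).
- move=> mu [[_ sum1] fm pf mk].
  (* Full marginals and positivity of the field make every weight positive, so [ln] inverts
     [psi]. *)
  have mu0 a : 0 < mu a by apply: pf.
  have psiE : psi (fun a => ln (mu a)) = mu.
    by apply/funext => a; rewrite /psi lnK ?posrE.
  exists (fun a => ln (mu a)) => //; split.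
    by rewrite -[RHS]sum1 -[in RHS]psiE.
  exact/local_potential_game/markov_local_potential.
Qed.
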